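(* Let the fading gains be i.i.d. with density $f(\gamma)=\frac{m^m\gamma^{m-1}}{\Gamma(m)}e^{-m\gamma}$, $\gamma\ge0$ ($m>0$), let $P>0$ and $0<R<M$ where $|\mathcal X|=2^M$. Among all (possibly randomized) power allocation rules satisfying the long-term constraint $\mathbb E\big[\frac1B\sum_bp_b(\boldsymbol\gamma)\big]\le P$, the outage probability $\Pr\big(\frac1B\sum_b I_{\mathcal X}(p_b\gamma_b)<R\big)$ is minimized by \[ \mathbf p^{\rm opt}_{\rm lt}(\boldsymbol\gamma)=\begin{cases}\boldsymbol\wp^{\rm opt}(\boldsymbol\gamma),&\overline{\boldsymbol\wp^{\rm opt}(\boldsymbol\gamma)}\le s,\\ \mathbf 0,&\text{otherwise},\end{cases} \] where $\boldsymbol\wp^{\rm opt}(\boldsymbol\gamma)$ solves: minimize $\overline{\boldsymbol\wp}$ subject to $\frac1B\sum_b I_{\mathcal X}(\wp_b\gamma_b)\ge R$, $\wp_b\ge0$; and $s=\infty$ if $\lim_{s\to\infty}\mathbb E[\overline{\boldsymbol\wp^{\rm opt}(\boldsymbol\gamma)}\mathbf 1\{\boldsymbol\gamma\in\mathcal R(s)\}]\le P$, otherwise $s$ satisfies $\mathbb E[\overline{\boldsymbol\wp^{\rm opt}(\boldsymbol\gamma)}\mathbf 1\{\boldsymbol\gamma\in\mathcal R(s)\}]=P$, with $\mathcal R(s)=\{\boldsymbol\gamma\in(0,\infty)^B:\overline{\boldsymbol\wp^{\rm opt}(\boldsymbol\gamma)}\le s\}$.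
   Context: $\overline{\mathbf x}=\frac1B\sum_{b=1}^Bx_b$. $\mathcal X\subset\mathbb C$ is a discrete constellation with $|\mathcal X|=2^M$, and $I_{\mathcal X}(\rho)$ is the mutual information (bits) of the AWGN channel $Y=\sqrt\rho X+Z$, $Z\sim\mathcal N_{\mathbb C}(0,1)$, $X$ uniform on $\mathcal X$ (coded modulation or BICM). *)

(* Defs.v *)
From HB Require Import structures.
From mathcomp Require Import all_boot all_order all_algebra.
From mathcomp Require Import all_classical all_reals all_analysis.
Set Implicit Arguments. Unset Strict Implicit. Unset Printing Implicit Defensive.
Import Order.TTheory GRing.Theory Num.Theory.
Import numFieldNormedType.Exports.
Local Open Scope classical_set_scope.
Local Open Scope ring_scope.

(* Complex numbers are represented as pairs (real part, imaginary part);
   Lebesgue measure on C = R x R is the product Lebesgue measure. *)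

Definition log2 (R : realType) (x : R) : R := ln x / ln 2.

(* Transition density of Y = sqrt(rho) X + Z, Z ~ N_C(0,1):
   W(y|x) = (1/pi) exp(-|y - sqrt(rho) x|^2). *)
Definition chan_density (R : realType) (rho : R) (x y : R * R) : R :=
  pi^-1 * expR (- ((y.1 - Num.sqrt rho * x.1) ^+ 2 + (y.2 - Num.sqrt rho * x.2) ^+ 2)).

Definition lebC (R : realType) :=
  ((@lebesgue_measure R) \x (@lebesgue_measure R))%E.

(* Constellation X = {X k : k < 2^M}.  Coded-modulation mutual information (bits),
   X uniform on the constellation:
   I = 2^-M sum_k int W(y|x_k) log2( W(y|x_k) / (2^-M sum_j W(y|x_j)) ) dy. *)
Definition I_CM (R : realType) (M : nat) (X : 'I_(2 ^ M) -> R * R) (rho : R) : R :=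
  (2 ^ M)%:R^-1 * \sum_(k < 2 ^ M)
    fine (\int[@lebC R]_y
      (chan_density rho (X k) y *
       log2 (chan_density rho (X k) y /
             ((2 ^ M)%:R^-1 * \sum_(j < 2 ^ M) chan_density rho (X j) y)))%:E)%E.

(* Binary labeling: point X k carries the binary expansion of k as its label
   (bit i of the label of X k is the i-th binary digit of k).  Since X is an
   arbitrary injective enumeration of the constellation, every labeling arises. *)
Definition label_bit (M : nat) (k : 'I_(2 ^ M)) (i : 'I_M) : bool := odd (k %/ 2 ^ i).

(* BICM mutual information: sum over bit levels i of I(C_i ; Y), with C_i the
   uniform i-th label bit:
   I(C_i;Y) = 2^-M sum_k int W(y|x_k)
      log2( (2^-(M-1) sum_{j : bit_i j = bit_i k} W(y|x_j)) / (2^-M sum_j W(y|x_j)) ) dy. *)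
Definition I_BICM (R : realType) (M : nat) (X : 'I_(2 ^ M) -> R * R) (rho : R) : R :=
  \sum_(i < M) ((2 ^ M)%:R^-1 * \sum_(k < 2 ^ M)
    fine (\int[@lebC R]_y
      (chan_density rho (X k) y *
       log2 (((2 ^ M.-1)%:R^-1 *
                \sum_(j < 2 ^ M | label_bit j i == label_bit k i) chan_density rho (X j) y) /
             ((2 ^ M)%:R^-1 * \sum_(j < 2 ^ M) chan_density rho (X j) y)))%:E)%E).

Inductive mod_scheme := CM | BICM.

Definition IX (R : realType) (sch : mod_scheme) (M : nat) (X : 'I_(2 ^ M) -> R * R) : R -> R :=
  match sch with CM => @I_CM R M X | BICM => @I_BICM R M X end.

Definition GammaFn (R : realType) (m : R) : R :=
  fine (\int[@lebesgue_measure R]_(t in `[0%R, +oo[) (powR t (m - 1) * expR (- t))%:E)%E.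

Definition nakagami_pdf (R : realType) (m : R) (g : R) : R :=
  if 0 <= g then powR m m * powR g (m - 1) / GammaFn m * expR (- (m * g)) else 0.

Definition vmean (R : realType) (B : nat) (v : 'I_B -> R) : R :=
  B%:R^-1 * \sum_(b < B) v b.

Definition mean_I (R : realType) (I : R -> R) (B : nat) (g p : 'I_B -> R) : R :=
  vmean (fun b => I (p b * g b)).

Definition pos_vec (R : realType) (B : nat) (g : 'I_B -> R) : Prop := forall b, 0 < g b.

Definition is_min_power (R : realType) (I : R -> R) (Rt : R) (B : nat)
    (g w : 'I_B -> R) : Prop :=
  [/\ forall b, 0 <= w b,
      Rt <= mean_I I g w
    & forall q : 'I_B -> R, (forall b, 0 <= q b) -> Rt <= mean_I I g q ->
        vmean w <= vmean q].

Definition Rregion (R : realType) (B : nat) (wp : ('I_B -> R) -> 'I_B -> R)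
    (s : \bar R) : set ('I_B -> R) :=
  [set g | pos_vec g /\ ((vmean (wp g))%:E <= s)%E].

Definition gvec (Omega : Type) (R : realType) (B : nat) (gam : 'I_B -> Omega -> R)
    (w : Omega) : 'I_B -> R := fun b => gam b w.

Definition ER (R : realType) (d : measure_display) (Omega : measurableType d)
    (Pr : probability Omega R) (B : nat) (gam : 'I_B -> Omega -> R)
    (wp : ('I_B -> R) -> 'I_B -> R) (s : \bar R) : \bar R :=
  (\int[Pr]_w (vmean (wp (gvec gam w)) * \1_(Rregion wp s) (gvec gam w))%:E)%E.

Definition threshold_spec (R : realType) (d : measure_display) (Omega : measurableType d)
    (Pr : probability Omega R) (B : nat) (gam : 'I_B -> Omega -> R)
    (wp : ('I_B -> R) -> 'I_B -> R) (P : R) (s : \bar R) : Prop :=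
  let L := lim ((fun t : R => ER Pr gam wp t%:E) @ +oo%R) in
  (s = +oo%E /\ (L <= P%:E)%E) \/
  (exists t : R, [/\ s = t%:E, (P%:E < L)%E & ER Pr gam wp t%:E = P%:E]).

Definition p_lt_opt (R : realType) (B : nat) (wp : ('I_B -> R) -> 'I_B -> R)
    (s : \bar R) (g : 'I_B -> R) : 'I_B -> R :=
  fun b => if g \in Rregion wp s then wp g b else 0.

Definition avg_power (R : realType) (d : measure_display) (Omega : measurableType d)
    (Pr : probability Omega R) (B : nat) (p : Omega -> 'I_B -> R) : \bar R :=
  (\int[Pr]_w (vmean (p w))%:E)%E.

Definition outage (R : realType) (d : measure_display) (Omega : measurableType d)
    (Pr : probability Omega R) (I : R -> R) (Rt : R) (B : nat)
    (gam : 'I_B -> Omega -> R) (p : Omega -> 'I_B -> R) : \bar R :=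
  Pr [set w | mean_I I (gvec gam w) (p w) < Rt].

(* Main.v *)
(* Write phi(g) for the minimal average power at gains g.  Sets of outage are
   governed by phi alone: an allocation avoiding outage at g spends at least
   phi(g), and the proposed rule avoids outage exactly where phi <= s.
   Optimality is then the Neyman-Pearson exchange argument: if D is the
   non-outage event of a competitor and A = {phi <= s}, then E[phi 1_D] <= P =
   E[phi 1_A], while phi > s on D \ A and phi <= s on A \ D, so Pr D <= Pr A.

   The minimizer need not depend measurably on g, but phi does, whatever the
   rate function: rescaling the powers shows c phi(g') <= phi(g) as soon as
   g' >= c g, hence {phi < t} is a countable union of orthants with rational
   corners. *)

Require Import Defs.
From HB Require Import structures.
From mathcomp Require Import all_boot all_order all_algebra.
From mathcomp Require Import all_classical all_reals all_analysis.
From mathcomp Require Import measurable_realfun.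
From mathcomp Require Import lra.
Set Implicit Arguments. Unset Strict Implicit. Unset Printing Implicit Defensive.
Import Order.TTheory GRing.Theory Num.Theory.
Import numFieldNormedType.Exports.
Local Open Scope classical_set_scope.
Local Open Scope ring_scope.

(** * Measurability of the mutual information *)

(* Tonelli's iterated form is needed since the product of two sigma-finite
   measures is not inferred to be sigma-finite. *)
Lemma measurable_integral_prod d1 d2 d3 (T1 : measurableType d1)
    (T2 : measurableType d2) (T3 : measurableType d3) (R : realType)
    (m2 : {sigma_finite_measure set T2 -> \bar R})
    (m3 : {sigma_finite_measure set T3 -> \bar R})
    (f : T1 * (T2 * T3) -> \bar R) :
  measurable_fun setT f -> (forall z, 0 <= f z)%E ->
  measurable_fun setT (fun x => \int[m2 \x m3]_y f (x, y))%E.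
Proof.
move=> mf f0.
(* Reassociated so that the [T3] variable is integrated out first, with parameters in [T1 * T2], and
   the [T2] variable second. *)
pose g (u : (T1 * T2) * T3) := f (u.1.1, (u.1.2, u.2)).
have mg : measurable_fun setT g.
  apply: measurableT_comp => //.
  have m1 : measurable_fun setT (fun u : (T1 * T2) * T3 => u.1) by exact: measurable_fst.
  apply: measurable_fun_pair; first exact: (measurableT_comp measurable_fst m1).
  by apply: measurable_fun_pair => //; exact: (measurableT_comp measurable_snd m1).
have mG := measurable_fun_fubini_tonelli_F (m2 := m3) g mg (fun=> f0 _).
have G0 u : (0 <= fubini_F m3 g u)%E by apply: integral_ge0 => y _; exact: f0.
have mH := measurable_fun_fubini_tonelli_F (m2 := m2) _ mG G0.
apply: eq_measurable_fun mH => x _.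
rewrite (fubini_tonelli1 (fun y => f (x, y)))//.
by apply: measurableT_comp => //; exact: measurable_fun_pair.
Qed.

(** Positive and negative parts fall under the nonnegative case, and the extended-real difference of
    their integrals is measurable whether or not it is finite. *)
Lemma measurable_fine_integral_prod d1 d2 d3 (T1 : measurableType d1)
    (T2 : measurableType d2) (T3 : measurableType d3) (R : realType)
    (m2 : {sigma_finite_measure set T2 -> \bar R})
    (m3 : {sigma_finite_measure set T3 -> \bar R})
    (f : T1 * (T2 * T3) -> R) :
  measurable_fun setT f ->
  measurable_fun setT (fun x => fine (\int[m2 \x m3]_y (f (x, y))%:E)%E).
Proof.
move=> mf.
have mEf : measurable_fun setT (EFin \o f) by exact/measurable_EFinP.
apply: (@measurableT_comp _ _ _ _ _ _ fine); first exact: fine_measurable.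
under eq_fun do rewrite integralE.
apply: emeasurable_funB.
- apply: eq_measurable_fun
    (measurable_integral_prod m2 m3 (measurable_funepos mEf) (funepos_ge0 _)).
  by move=> x _; apply: eq_integral => y _; rewrite !funeposE.
- apply: eq_measurable_fun
    (measurable_integral_prod m2 m3 (measurable_funeneg mEf) (funeneg_ge0 _)).
  by move=> x _; apply: eq_integral => y _; rewrite !funenegE.
Qed.

Lemma measurable_fine_integral_lebC (R : realType) (h : R * (R * R) -> R) :
  measurable_fun setT h ->
  measurable_fun setT (fun rho : R => fine (\int[@lebC R]_y (h (rho, y))%:E)%E).
Proof.
move=> mh; exact: (@measurable_fine_integral_prod _ _ _ R _ _ R
  (@lebesgue_measure R) (@lebesgue_measure R) h mh).
Qed.

Lemma measurable_sqrt (R : realType) : measurable_fun setT (@Num.sqrt R).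
Proof. by apply: continuous_measurable_fun; exact: sqrt_continuous. Qed.

Lemma measurable_log2 (R : realType) : measurable_fun setT (@log2 R).
Proof. by apply: measurable_funM => //; exact: measurable_ln. Qed.

(** Inversion is continuous away from 0, and the remaining point is a measurable singleton. *)
Lemma measurable_inv (R : realType) : measurable_fun setT (@GRing.inv R).
Proof.
rewrite -(setUv [set 0 : R]); apply/measurable_funU => //.
  exact: measurableC.
split; first exact: measurable_fun_set1.
apply: open_continuous_measurable_fun; first exact/closed_openC/closed_eq.
by move=> x; rewrite inE/= => /eqP x0; exact: inv_continuous.
Qed.

Lemma measurable_chan_density (R : realType) (x : R * R) :
  measurable_fun setT (fun z : R * (R * R) => chan_density z.1 x z.2).
Proof.
apply: measurable_funM => //.
apply: measurableT_comp; first exact: measurable_expR.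
have msq : measurable_fun setT (fun z : R * (R * R) => Num.sqrt z.1).
  by apply: measurableT_comp; [exact: measurable_sqrt | exact: measurable_fst].
have m21 : measurable_fun setT (fun z : R * (R * R) => z.2.1).
  by apply: measurableT_comp; [exact: measurable_fst | exact: measurable_snd].
have m22 : measurable_fun setT (fun z : R * (R * R) => z.2.2).
  by apply: measurableT_comp; [exact: measurable_snd | exact: measurable_snd].
apply: (@measurableT_comp _ _ _ _ _ _ (@GRing.opp R)) => //.
by apply: measurable_funD; apply: measurable_funX; apply: measurable_funB => //;
  apply: measurable_funM.
Qed.

Lemma measurable_I_CM (R : realType) (M : nat) (X : 'I_(2 ^ M) -> R * R) :
  measurable_fun setT (I_CM X).
Proof.
apply: measurable_funM => //; apply: measurable_sum => k.
apply: (@measurable_fine_integral_lebC R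
  (fun z : R * (R * R) => chan_density z.1 (X k) z.2 *
    log2 (chan_density z.1 (X k) z.2 /
      ((2 ^ M)%:R^-1 * \sum_(j < 2 ^ M) chan_density z.1 (X j) z.2)))).
have mW := fun j => measurable_chan_density (X j).
apply: measurable_funM => //.
apply: (measurableT_comp (@measurable_log2 R)).
apply: measurable_funM => //.
apply: (measurableT_comp (@measurable_inv R)).
by apply: measurable_funM => //; exact: measurable_sum.
Qed.

Lemma measurable_I_BICM (R : realType) (M : nat) (X : 'I_(2 ^ M) -> R * R) :
  measurable_fun setT (I_BICM X).
Proof.
apply: measurable_sum => i.
apply: measurable_funM => //; apply: measurable_sum => k.
apply: (@measurable_fine_integral_lebC R
  (fun z : R * (R * R) => chan_density z.1 (X k) z.2 *
    log2 (((2 ^ M.-1)%:R^-1 *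
        \sum_(j < 2 ^ M | label_bit j i == label_bit k i)
           chan_density z.1 (X j) z.2) /
      ((2 ^ M)%:R^-1 * \sum_(j < 2 ^ M) chan_density z.1 (X j) z.2)))).
have mW := fun j => measurable_chan_density (X j).
apply: measurable_funM => //.
apply: (measurableT_comp (@measurable_log2 R)).
apply: measurable_funM => //.
  apply: measurable_funM => //.
  by under eq_fun do rewrite -big_filter; exact: measurable_sum.
apply: (measurableT_comp (@measurable_inv R)).
by apply: measurable_funM => //; exact: measurable_sum.
Qed.

Lemma measurable_IX (R : realType) (sch : mod_scheme) (M : nat)
  (X : 'I_(2 ^ M) -> R * R) : measurable_fun setT (IX sch X).
Proof. by case: sch; [exact: measurable_I_CM | exact: measurable_I_BICM]. Qed.

(** * The mutual information vanishes at zero SNR *)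

Lemma chan_density0 (R : realType) (x y : R * R) :
  chan_density 0 x y = pi^-1 * expR (- (y.1 ^+ 2 + y.2 ^+ 2)).
Proof. by rewrite /chan_density sqrtr0 !mul0r !subr0. Qed.

Lemma log2_1 (R : realType) : log2 1 = 0 :> R.
Proof. by rewrite /log2 ln1 mul0r. Qed.

(** At zero SNR the output density does not depend on the transmitted point, so its average over any
    nonempty set of points is that same density. All likelihood ratios are then 1. *)
Lemma sum_chan_density0 (R : realType) (n : nat) (I : finType) (P : pred I)
    (X : I -> R * R) (y : R * R) (x : R * R) : #|P| = n -> (0 < n)%N ->
  n%:R^-1 * \sum_(j | P j) chan_density 0 (X j) y = chan_density 0 x y.
Proof.
move=> Pn n0; under eq_bigr do rewrite chan_density0.
have -> : \sum_(j | P j) (pi^-1 * expR (- (y.1 ^+ 2 + y.2 ^+ 2))) =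
  pi^-1 * expR (- (y.1 ^+ 2 + y.2 ^+ 2)) *+ n by rewrite -Pn -sumr_const.
by rewrite -(chan_density0 x) -[X in _^-1 * X]mulr_natl mulKf// pnatr_eq0 -lt0n.
Qed.

Lemma chan_density_neq0 (R : realType) (rho : R) (x y : R * R) :
  chan_density rho x y != 0.
Proof. by rewrite mulf_neq0 ?invr_neq0 ?gt_eqF ?pi_gt0 ?expR_gt0. Qed.

Lemma I_CM0 (R : realType) (M : nat) (X : 'I_(2 ^ M) -> R * R) : I_CM X 0 = 0.
Proof.
rewrite /I_CM big1 ?mulr0// => k _.
under eq_integral.
  move=> y _.
  rewrite (@sum_chan_density0 _ _ _ _ _ _ (X k)) ?card_ord ?expn_gt0//.
  rewrite divff ?chan_density_neq0// log2_1 mulr0; over.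
by rewrite integral0.
Qed.

(** Toggles the [i]-th binary digit of [j]; it provides the bijection between the labels having bit
    0 and bit 1 in position [i]. *)
Definition flip_bit (i j : nat) : nat :=
  (if odd (j %/ 2 ^ i) then j - 2 ^ i else j + 2 ^ i)%N.

Lemma odd_flip_bit (i j : nat) : odd (flip_bit i j %/ 2 ^ i)%N = ~~ odd (j %/ 2 ^ i)%N.
Proof.
have p0 : (0 < 2 ^ i)%N by rewrite expn_gt0.
rewrite /flip_bit; case: ifP => o; last first.
  by rewrite divnDr// divnn p0 addn1 /= o.
have le : (2 ^ i <= j)%N.
  by rewrite -divn_gt0 ?p0//; move: o; case: (j %/ 2 ^ i)%N.
by rewrite -{1}(subnK le) divnDr// divnn p0 addn1/= in o; rewrite (negbTE o).
Qed.

Lemma flip_bitK (i : nat) : involutive (flip_bit i).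
Proof.
move=> j; rewrite {1}/flip_bit odd_flip_bit /flip_bit.
have p0 : (0 < 2 ^ i)%N by rewrite expn_gt0.
case o : (odd (j %/ 2 ^ i)%N) => /=; last by rewrite addnK.
by rewrite subnK// -divn_gt0 ?p0//; move: o; case: (j %/ 2 ^ i)%N.
Qed.

Lemma flip_bit_lt (M i j : nat) :
  (i < M)%N -> (j < 2 ^ M)%N -> (flip_bit i j < 2 ^ M)%N.
Proof.
move=> iM jM; rewrite /flip_bit; case: ifP => o.
  exact: leq_ltn_trans (leq_subr _ _) jM.
have p0 : (0 < 2 ^ i)%N by rewrite expn_gt0.
rewrite -(subnKC (ltnW iM)) expnD mulnC -ltn_divLR//.
rewrite divnDr// divnn p0 addn1.
have : (j %/ 2 ^ i < 2 ^ (M - i))%N.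
  by rewrite ltn_divLR// mulnC -expnD subnKC// ltnW.
(* Adding one to the quotient reaches [2 ^ (M - i)] only if the quotient is odd, since this power is
   even for [i < M]; but here the digit is 0. *)
rewrite leq_eqVlt => /orP[/eqP e|//].
move: o; have : odd (j %/ 2 ^ i)%N.+1 = false.
  by rewrite e oddX subn_eq0 leqNgt iM.
by move=> /= /negbFE ->.
Qed.

(** Toggling digit [i] exchanges the class with its complement, so each contains half of the [2 ^ M]
    labels. *)
Lemma card_label_bit (M : nat) (i : 'I_M) (b : bool) :
  #|[pred j : 'I_(2 ^ M) | label_bit j i == b]| = (2 ^ M.-1)%N.
Proof.
pose h (j : 'I_(2 ^ M)) := Ordinal (flip_bit_lt (ltn_ord i) (ltn_ord j)).
have hK : involutive h by move=> j; apply: val_inj; exact: flip_bitK.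
have hb j : label_bit (h j) i = ~~ label_bit j i by exact: odd_flip_bit.
have E : #|[pred j : 'I_(2 ^ M) | label_bit j i == b]| =
         #|[predC [pred j : 'I_(2 ^ M) | label_bit j i == b]]|.
  rewrite -!sum1_card (reindex_inj (inv_inj hK)); apply: eq_bigl => j.
  by rewrite !inE hb; case: (label_bit j i); case: b.
have := cardC [pred j : 'I_(2 ^ M) | label_bit j i == b].
rewrite -E addnn card_ord => e; apply: double_inj; rewrite e.
by rewrite -mul2n -expnS prednK// (leq_ltn_trans _ (ltn_ord i)).
Qed.

Lemma I_BICM0 (R : realType) (M : nat) (X : 'I_(2 ^ M) -> R * R) :
  I_BICM X 0 = 0.
Proof.
rewrite /I_BICM big1// => i _; rewrite big1 ?mulr0// => k _.
under eq_integral.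
  move=> y _.
  rewrite (@sum_chan_density0 _ _ _ _ _ _ (X k)) ?card_label_bit ?expn_gt0//.
  rewrite (@sum_chan_density0 _ _ _ _ _ _ (X k)) ?card_ord ?expn_gt0//.
  rewrite divff ?chan_density_neq0// log2_1 mulr0; over.
by rewrite integral0.
Qed.

(** Ensures that switching the power off puts the channel in outage for any positive target rate. *)
Lemma IX0 (R : realType) (sch : mod_scheme) (M : nat)
  (X : 'I_(2 ^ M) -> R * R) : IX sch X 0 = 0.
Proof. by case: sch; [exact: I_CM0 | exact: I_BICM0]. Qed.

(** * The minimal power *)

Lemma ler_vmean (R : realType) (B : nat) (u v : 'I_B -> R) :
  (forall b, u b <= v b) -> vmean u <= vmean v.
Proof.
by move=> uv; rewrite ler_wpM2l ?invr_ge0//; apply: ler_sum => b _.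
Qed.

Lemma vmean_ge0 (R : realType) (B : nat) (u : 'I_B -> R) :
  (forall b, 0 <= u b) -> 0 <= vmean u.
Proof. by move=> u0; rewrite mulr_ge0 ?invr_ge0 ?sumr_ge0. Qed.

Lemma vmeanZ (R : realType) (B : nat) (c : R) (u : 'I_B -> R) :
  vmean (fun b => c * u b) = c * vmean u.
Proof. by rewrite /vmean -mulr_sumr mulrCA. Qed.

Lemma vmean0 (R : realType) (B : nat) : vmean (fun _ : 'I_B => 0) = 0 :> R.
Proof. by rewrite /vmean big1 ?mulr0. Qed.

(* Rescaling the powers so that the received powers [q b * g b] are unchanged
   turns a feasible allocation for [g] into one for [g']. *)
Lemma min_power_scale (R : realType) (I : R -> R) (Rt c : R) (B : nat)
    (g g' w w' : 'I_B -> R) : 0 < c ->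
  pos_vec g -> (forall b, c * g b <= g' b) ->
  is_min_power I Rt g w -> is_min_power I Rt g' w' -> c * vmean w' <= vmean w.
Proof.
move=> c0 g0 gg' [w0 wR _] [_ _ w'min].
have g'0 b : 0 < g' b by apply: lt_le_trans (gg' b); rewrite mulr_gt0.
pose q b := w b * (g b / g' b).
have q0 b : 0 <= q b by rewrite mulr_ge0// divr_ge0// ltW.
have qR : Rt <= mean_I I g' q.
  rewrite (le_trans wR)// /mean_I /vmean.
  under [X in _ <= _ * X]eq_bigr do rewrite /q -mulrA divfK ?gt_eqF//.
  exact: lexx.
rewrite (le_trans (ler_wpM2l (ltW c0) (w'min q q0 qR)))// -vmeanZ.
apply: ler_vmean => b; rewrite /q mulrCA ler_piMr// mulrA.
by rewrite ler_pdivrMr// mul1r.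
Qed.

(** * Measurability of the minimal power on positive gains *)

Section min_power_measurable.
Context {R : realType} {d : measure_display} {Omega : measurableType d}
  {B : nat} {gam : 'I_B -> Omega -> R} {J : R -> R} {Rt : R}
  {wp : ('I_B -> R) -> 'I_B -> R}.
Hypothesis gam_meas : forall b, measurable_fun setT (gam b).
Hypothesis wpP : forall g, pos_vec g -> is_min_power J Rt g (wp g).

Let ratvec (r : {ffun 'I_B -> rat}) : 'I_B -> R := fun b => ratr (r b).

Lemma measurable_gam_ge (h : 'I_B -> R) :
  measurable [set w | forall b, h b <= gam b w].
Proof.
rewrite (_ : [set _ | _] = \bigcap_(b in setT) (gam b @^-1` `[h b, +oo[)).
  apply: fin_bigcap_measurable => // b _.
  by rewrite -[X in measurable X]setTI; exact: gam_meas.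
apply/seteqP; split => w /= h1 b; first by move=> _; rewrite /= in_itv/= h1.
by have := h1 b I; rewrite /= in_itv/= andbT.
Qed.

Lemma min_power_lt_bigcup (t : R) :
  [set w | pos_vec (gvec gam w) /\ vmean (wp (gvec gam w)) < t] =
  \bigcup_(r in [set r | pos_vec (ratvec r) /\ vmean (wp (ratvec r)) < t])
    [set w | forall b, ratvec r b <= gam b w].
Proof.
apply/seteqP; split => w /=.
- set g := gvec gam w => -[g0 gt].
  have v0 : 0 <= vmean (wp g) by apply: vmean_ge0; case: (wpP g0).
  have t0 : 0 < t by exact: le_lt_trans gt.
  (* The midpoint of [vmean (wp g) / t] and 1: [c < 1] leaves room for rationals between [c * g b]
     and [g b], and [vmean (wp g) < c * t] keeps the minimal power at the rational corner below
     [t]. *)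
  pose c := (vmean (wp g) / t + 1) / 2.
  have vt1 : vmean (wp g) / t < 1 by rewrite ltr_pdivrMr// mul1r.
  have c1 : c < 1 by rewrite /c; lra.
  have vtc : vmean (wp g) / t < c by rewrite /c; lra.
  have c0 : 0 < c by rewrite (le_lt_trans _ vtc)// divr_ge0// ltW.
  have cg b : c * g b < g b by rewrite gtr_pMl.
  have rP b : {r : rat | c * g b < ratr r < g b}.
    by apply: cid; have [r rb] := rat_in_itvoo (cg b); exists r; rewrite in_itv/= in rb.
  pose r := [ffun b => sval (rP b)].
  have rE b : c * g b < ratvec r b < g b by rewrite /ratvec ffunE; exact: (svalP (rP b)).
  exists r => /=; last by move=> b; have /andP[_ /ltW] := rE b.
  have r0 : pos_vec (ratvec r).
    by move=> b; have /andP[+ _] := rE b; apply: lt_trans; rewrite mulr_gt0.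
  split=> //.
  have := min_power_scale c0 g0 (fun b => ltW (proj1 (andP (rE b)))) (wpP g0) (wpP r0).
  move=> cr; have := le_lt_trans cr (_ : vmean (wp g) < c * t).
  by rewrite ltr_pM2l//; apply; rewrite -ltr_pdivrMr.
(* Conversely, scaling with factor 1 says that larger gains never need more power. *)
- move=> [r [r0 rt] rg].
  have g0 : pos_vec (gvec gam w) by move=> b; exact: lt_le_trans (rg b).
  split=> //; apply: le_lt_trans rt; rewrite -[leLHS]mul1r.
  by apply: (min_power_scale ltr01 r0 _ (wpP r0) (wpP g0)) => b; rewrite mul1r.
Qed.

Lemma measurable_pos_vec : measurable [set w | pos_vec (gvec gam w)].
Proof.
rewrite (_ : [set _ | _] = \bigcap_(b in setT) (gam b @^-1` `]0, +oo[)).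
  apply: fin_bigcap_measurable => // b _.
  by rewrite -[X in measurable X]setTI; exact: gam_meas.
apply/seteqP; split => w /= h1 b; first by move=> _; rewrite /= in_itv/= h1.
by have := h1 b I; rewrite /= in_itv/= andbT.
Qed.

Lemma measurable_min_power :
  measurable_fun [set w | pos_vec (gvec gam w)] (fun w => vmean (wp (gvec gam w))).
Proof.
move=> mpos; apply: (measurability _ (RGenInftyO.measurableE R)) => //.
move=> _ [_ [t ->] <-].
rewrite (_ : _ `&` _ =
  [set w | pos_vec (gvec gam w) /\ vmean (wp (gvec gam w)) < t]); last first.
  by apply/seteqP; split => w /= []; rewrite in_itv/=.
rewrite min_power_lt_bigcup; rewrite bigcup_mkcond.
apply: countable_bigcupT_measurable => [|r]; first exact: countableP.
by case: ifP => // _; exact: measurable_gam_ge.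
Qed.

End min_power_measurable.

(** * Positivity of the fading gains *)

Lemma GammaFn_ge0 (R : realType) (m : R) : 0 <= GammaFn m.
Proof.
apply: fine_ge0; apply: integral_ge0 => x _.
by rewrite lee_fin mulr_ge0 ?powR_ge0 ?expR_ge0.
Qed.

Lemma nakagami_pdf_ge0 (R : realType) (m x : R) : 0 <= nakagami_pdf m x.
Proof.
rewrite /nakagami_pdf; case: ifP => // _.
by rewrite !mulr_ge0 ?invr_ge0 ?GammaFn_ge0 ?powR_ge0 ?expR_ge0.
Qed.

Lemma measurable_nakagami_pdf (R : realType) (m : R) :
  measurable_fun setT (nakagami_pdf m).
Proof.
apply: measurable_fun_ifT => //; first exact: measurable_fun_ler.
apply: measurable_funM.
  by apply: measurable_funM => //; apply: measurable_funM.
apply: (measurableT_comp (@measurable_expR R)).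
by apply: (measurableT_comp (@oppr_measurable R setT)); exact: measurable_funM.
Qed.

(** The density is zero on the negative axis, so the integrands can differ only at the null point
    0. *)
Lemma integral_nakagami_pdf_gt0 (R : realType) (m : R) :
  (\int[@lebesgue_measure R]_(x in `]0%R, +oo[) (nakagami_pdf m x)%:E =
   \int[@lebesgue_measure R]_x (nakagami_pdf m x)%:E)%E.
Proof.
have mf : measurable_fun setT (EFin \o nakagami_pdf m).
  by apply/measurable_EFinP; exact: measurable_nakagami_pdf.
rewrite integral_mkcond; apply: ge0_ae_eq_integral => //.
- by apply/(measurable_restrictT _ _).1 => //; exact: measurable_funTS.
- by move=> x _; apply: erestrict_ge0 => y _; rewrite lee_fin nakagami_pdf_ge0.
- by move=> x _; rewrite lee_fin nakagami_pdf_ge0.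
exists [set 0]; split; [exact: measurable_set1 | exact: lebesgue_measure_set1 |].
move=> x /= /not_implyP[_]; rewrite patchE; case: ifPn => [//|].
rewrite notin_setE/= in_itv/= andbT /nakagami_pdf; case: ifP => // x0 x1 _.
by apply/eqP; rewrite eq_le x0 leNgt andbT; exact/negP.
Qed.

(** The product formula gives the same value for the positive orthant as for the whole space, so the
    total mass of the density is never computed: it is forced by [Pr setT = 1]. *)
Lemma pos_vec_as (R : realType) (d : measure_display) (Omega : measurableType d)
    (Pr : probability Omega R) (B : nat) (m : R) (gam : 'I_B -> Omega -> R) :
  (forall A : 'I_B -> set R, (forall b, measurable (A b)) ->
     Pr (\bigcap_(b in setT) (gam b @^-1` A b)) =
     (\prod_(b < B) \int[@lebesgue_measure R]_(x in A b) (nakagami_pdf m x)%:E)%E) ->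
  Pr [set w | pos_vec (gvec gam w)] = 1%E.
Proof.
move=> gamP.
rewrite (_ : [set _ | _] = \bigcap_(b in setT) (gam b @^-1` `]0, +oo[)).
  rewrite gamP//; under eq_bigr do rewrite integral_nakagami_pdf_gt0.
  by rewrite -gamP// -(@probability_setT _ _ _ Pr); congr (Pr _); apply/seteqP.
apply/seteqP; split => w /= h1 b; first by move=> _; rewrite /= in_itv/= h1.
by have := h1 b I; rewrite /= in_itv/= andbT.
Qed.

(** * Optimality of the threshold rule *)

(* Exchange argument of the Neyman-Pearson lemma: [f <= t] on [A `\` D] while
   [f >= t] on [D `\` A]. *)
Lemma measure_le_of_integral_le d (T : measurableType d) (R : realType)
    (mu : {finite_measure set T -> \bar R}) (f : T -> \bar R) (A D : set T)
    (t : R) : 0 < t -> measurable A -> measurable D ->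
  measurable_fun (A `|` D) f -> (forall x, 0 <= f x)%E ->
  (forall x, A x -> f x <= t%:E)%E -> (forall x, D x -> ~ A x -> t%:E <= f x)%E ->
  (\int[mu]_(x in A) f x < +oo)%E ->
  (\int[mu]_(x in D) f x <= \int[mu]_(x in A) f x)%E -> (mu D <= mu A)%E.
Proof.
move=> t0 mA mD mf f0 At Dt Afin DA.
have mAD := measurableD mA mD; have mDA := measurableD mD mA.
have mI := measurableI _ _ mA mD; have mU := measurableU _ _ mA mD.
have sub C : C `<=` A `|` D -> measurable_fun C f by move=> /measurable_funS; exact.
have splitI (E F : set T) : measurable E -> measurable F -> E `<=` A `|` D ->
    (\int[mu]_(x in E) f x =
     \int[mu]_(x in E `\` F) f x + \int[mu]_(x in E `&` F) f x)%E.
  move=> mE mF EAD; have EE : E `\` F `|` E `&` F = E by rewrite -setDDr setDv setD0.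
  rewrite -ge0_integral_setU ?EE//.
  - exact: measurableD.
  - exact: measurableI.
  - exact: sub.
  - by rewrite disj_set2E setDE setIACA setICl setI0.
(* The common part [A]&[D] cancels from both integrals because its integral is finite. *)
have intle : (\int[mu]_(x in D `\` A) f x <= \int[mu]_(x in A `\` D) f x)%E.
  move: DA; rewrite (splitI _ _ mD mA); last exact: subsetUr.
  rewrite (splitI _ _ mA mD); last exact: subsetUl.
  rewrite (setIC D A) leeD2rE// ge0_fin_numE; last exact: integral_ge0.
  apply: le_lt_trans Afin; apply: ge0_subset_integral => //; apply: sub.
  exact: subsetUl.
have le1 : (t%:E * mu (D `\` A) <= \int[mu]_(x in D `\` A) f x)%E.
  rewrite -integral_cst//; apply: ge0_le_integral => //.
  - by move=> x _; rewrite lee_fin ltW.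
  - by apply: sub => x [Dx _]; right.
  - by move=> x [Dx nAx]; exact: Dt.
have le2 : (\int[mu]_(x in A `\` D) f x <= t%:E * mu (A `\` D))%E.
  rewrite -integral_cst//; apply: ge0_le_integral => //.
  - by apply: sub => x [Ax _]; left.
  - by move=> x [Ax _]; exact: At.
rewrite (measureDI mu mD mA) (measureDI mu mA mD) (setIC D A) leeD2r//.
by rewrite -(@lee_pmul2l _ t%:E) ?lte_fin//; exact: le_trans le1 (le_trans intle le2).
Qed.

(** * Power, outage event and optimality of the threshold rule *)

Section long_term_allocation.
Context {R : realType} {d : measure_display} {Omega : measurableType d}
  {Pr : probability Omega R} {B : nat} {gam : 'I_B -> Omega -> R}
  {J : R -> R} {Rt : R} {wp : ('I_B -> R) -> 'I_B -> R}.
Hypothesis gam_meas : forall b, measurable_fun setT (gam b).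
Hypothesis wpP : forall g, pos_vec g -> is_min_power J Rt g (wp g).

Let phi (w : Omega) : R := vmean (wp (gvec gam w)).
Let E : set Omega := [set w | pos_vec (gvec gam w)].
Let A (s : \bar R) : set Omega := [set w | Rregion wp s (gvec gam w)].

Let mE : measurable E. Proof. exact: measurable_pos_vec. Qed.

Let mphi : measurable_fun E phi. Proof. exact: (measurable_min_power gam_meas wpP). Qed.

Let phi_ge0 w : E w -> 0 <= phi w.
Proof. by move=> /wpP[w0 _ _]; exact: vmean_ge0. Qed.

Let AE s : A s `<=` E. Proof. by move=> w []. Qed.

Let Ay : A +oo%E = E.
Proof. by apply/seteqP; split => w; [case | move=> Ew; split; rewrite ?leey]. Qed.

Lemma measurable_Rregion s : measurable (A s).
Proof.
rewrite (_ : A s = E `&` [set w | (EFin \o phi) w <= s]%E).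
  by apply: emeasurable_fun_infty_c => //; exact/measurable_EFinP.
by apply/seteqP; split.
Qed.

(** Moves the indicator into the domain, which lies in [E], where [phi] is measurable and
    nonnegative. *)
Lemma ER_integral s : ER Pr gam wp s = (\int[Pr]_(w in A s) (phi w)%:E)%E.
Proof.
rewrite [RHS]integral_mkcond; apply: eq_integral => w _.
rewrite patchE indicE /phi; have [wA|wA] := boolP (w \in A s).
  by rewrite (_ : _ \in _ = true) ?mulr1//; rewrite inE in wA; rewrite inE.
rewrite (_ : _ \in _ = false) ?mulr0//; apply/negbTE; move: wA.
by rewrite !notin_setE.
Qed.

Lemma avg_power_p_lt_opt s :
  avg_power Pr (fun w => p_lt_opt wp s (gvec gam w)) = ER Pr gam wp s.
Proof.
apply: eq_integral => w _; congr EFin; rewrite indicE /p_lt_opt.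
by case: (_ \in _); rewrite ?mulr1 ?mulr0 ?vmean0.
Qed.

Lemma ER_nondecreasing : nondecreasing_fun (fun t : R => ER Pr gam wp t%:E).
Proof.
move=> t u tu; rewrite !ER_integral; apply: ge0_subset_integral.
- exact: measurable_Rregion.
- exact: measurable_Rregion.
- by apply/measurable_EFinP; apply: measurable_funS mphi.
- by move=> w /AE Ew; rewrite lee_fin phi_ge0.
- by move=> w [Ew le]; split => //; rewrite (le_trans le)// lee_fin.
Qed.

(** For an infinite threshold the budget bounds the limit, whereas the rule spends the value at
    [+oo]. Monotone convergence along integer thresholds, whose regions exhaust [E], compares the
    two; by monotonicity the limit is a supremum. *)
Lemma ER_pinfty_le :
  (ER Pr gam wp +oo <= lim ((fun t : R => ER Pr gam wp t%:E) @ +oo%R))%E.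
Proof.
rewrite (cvg_lim _ (nondecreasing_cvge ER_nondecreasing))//.
have AU : E = \bigcup_n A n%:R%:E.
  apply/seteqP; split => w; last by move=> [n _ /AE].
  move=> Ew; exists (Num.bound (phi w)) => //; split => //.
  by rewrite lee_fin ltW//; exact/archi_boundP/phi_ge0.
have nA : nondecreasing_seq (fun n : nat => A n%:R%:E).
  move=> n k nk; apply/subsetPset => w [Ew le]; split => //.
  by rewrite (le_trans le)// lee_fin ler_nat.
have cvgA : (ER Pr gam wp n%:R%:E @[n --> \oo] --> ER Pr gam wp +oo)%E.
  rewrite ER_integral Ay [in X in _ --> X]AU.
  under eq_fun do rewrite ER_integral.
  apply: ge0_nondecreasing_set_cvg_integral => // n.
  - exact: measurable_Rregion.
  - by apply/measurable_EFinP; apply: measurable_funS mphi.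
  - by move=> w /AE Ew; rewrite lee_fin phi_ge0.
rewrite -(cvg_lim _ cvgA)//; apply: lime_le; first exact: cvgP cvgA.
by apply: nearW => n; apply: ereal_sup_ubound; exists n%:R.
Qed.

(** On [A s] the minimizer meets the target; elsewhere all powers are 0 and the rate is
    [J 0 = 0 < Rt]. *)
Lemma outage_p_lt_opt s : J 0 = 0 -> 0 < Rt ->
  outage Pr J Rt gam (fun w => p_lt_opt wp s (gvec gam w)) = Pr (~` A s).
Proof.
move=> J0 Rt0; congr (Pr _); apply/seteqP; split => w /=; last first.
  move=> nA; rewrite /mean_I (_ : (fun b => _) = fun=> 0) ?vmean0//.
  apply/funext => b; rewrite /p_lt_opt memNset; last exact: nA.
  by rewrite mul0r J0.
move=> + Aw; apply/negP; rewrite -leNgt.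
have [_ wR _] := wpP Aw.1; rewrite (le_trans wR)//.
by rewrite /mean_I /p_lt_opt mem_set//; exact: lexx.
Qed.

(** The competitor [p] is a function of the sample point, not only of the gains, which covers
    randomized rules. An infinite threshold is immediate as [E] has probability one; a finite one
    uses the exchange argument. *)
Lemma measure_feasible_le (P : R) (s : \bar R) (D : set Omega)
    (p : Omega -> 'I_B -> R) :
  Pr E = 1%E -> 0 < P -> threshold_spec Pr gam wp P s ->
  (forall b, measurable_fun setT (fun w => p w b)) ->
  (forall w b, 0 <= p w b) -> (avg_power Pr p <= P%:E)%E ->
  measurable D -> D `<=` E -> (forall w, D w -> Rt <= mean_I J (gvec gam w) (p w)) ->
  (Pr D <= Pr (A s))%E.
Proof.
move=> PrE P0 sP mp p0 pP mD DE DR.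
case: sP => [[-> _]|[t [-> _ ERt]]]; first by rewrite Ay PrE probability_le1.
have mvp : measurable_fun setT (fun w => (vmean (p w))%:E).
  apply/measurable_EFinP; apply: measurable_funM => //.
  exact: measurable_sum.
have mA := measurable_Rregion t%:E.
have AP : (\int[Pr]_(w in A t%:E) (phi w)%:E = P%:E)%E by rewrite -ER_integral.
have mphiS C : C `<=` E -> measurable_fun C (EFin \o phi).
  by move=> CE; apply/measurable_EFinP; apply: measurable_funS mphi.
(* If [t <= 0], then [phi] vanishes on the region and its integral is 0 instead of [P > 0]. *)
have t0 : 0 < t.
  rewrite ltNge; apply/negP => t0; move: P0; rewrite -lte_fin -AP; apply/negP.
  rewrite -leNgt integral0_eq// => w [Ew le].
  by apply/eqP; rewrite eq_le !lee_fin phi_ge0// andbT (le_trans _ t0)// -lee_fin.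
(* On [D] the competitor meets the target, so it spends at least [phi] there. *)
have DP : (\int[Pr]_(w in D) (phi w)%:E <= P%:E)%E.
  apply: le_trans pP; rewrite /avg_power.
  apply: (@le_trans _ _ (\int[Pr]_(w in D) (vmean (p w))%:E)%E).
    apply: ge0_le_integral => //.
    - by move=> w Dw; rewrite lee_fin phi_ge0//; exact: DE.
    - exact: mphiS.
    - exact: measurable_funTS.
    - move=> w Dw; rewrite lee_fin.
      by have [_ _] := wpP (DE _ Dw); apply => //; exact: DR.
  apply: ge0_subset_integral => // w _.
  by rewrite lee_fin vmean_ge0.
(* Nothing controls [phi] off [E]; its extension by zero is nonnegative everywhere and has the same
   integrals over subsets of [E]. *)
have patchA C : C `<=` E ->
    (\int[Pr]_(w in C) ((EFin \o phi) \_ E) w = \int[Pr]_(w in C) (phi w)%:E)%E.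
  by move=> CE; apply: eq_integral => w wC; rewrite patchE mem_set//; apply: CE; rewrite inE in wC.
apply: (measure_le_of_integral_le (f := (EFin \o phi) \_ E) t0) => //.
- by apply: measurable_funTS; apply/(measurable_restrictT _ mE); exact: mphiS.
- by move=> w; apply: erestrict_ge0 => x Ex; rewrite lee_fin phi_ge0.
- by move=> w [Ew le]; rewrite patchE mem_set.
- move=> w Dw nA; rewrite patchE mem_set; last exact: DE.
  rewrite lee_fin leNgt; apply/negP => lt; apply: nA; split; first exact: DE.
  by rewrite lee_fin ltW.
- by rewrite patchA ?AP ?ltry.
- by rewrite !patchA// AP.
Qed.

End long_term_allocation.

Theorem theorem4 (R : realType) (d : measure_display) (Omega : measurableType d)
    (Pr : probability Omega R) (sch : mod_scheme) (M B : nat)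
    (X : 'I_(2 ^ M) -> R * R) (m P Rt : R)
    (gam : 'I_B -> Omega -> R) (wp : ('I_B -> R) -> 'I_B -> R) (s : \bar R) :
  (0 < B)%N -> injective X -> 0 < m -> 0 < P -> 0 < Rt -> Rt < M%:R ->
  (forall b, measurable_fun setT (gam b)) ->
  (forall A : 'I_B -> set R, (forall b, measurable (A b)) ->
     Pr (\bigcap_(b in setT) (gam b @^-1` A b)) =
     (\prod_(b < B) \int[@lebesgue_measure R]_(x in A b) (nakagami_pdf m x)%:E)%E) ->
  (forall g : 'I_B -> R, pos_vec g -> is_min_power (IX sch X) Rt g (wp g)) ->
  threshold_spec Pr gam wp P s ->
  (avg_power Pr (fun w => p_lt_opt wp s (gvec gam w)) <= P%:E)%E /\
  (forall p : Omega -> 'I_B -> R,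
     (forall b, measurable_fun setT (fun w => p w b)) ->
     (forall w b, 0 <= p w b) ->
     (avg_power Pr p <= P%:E)%E ->
     (outage Pr (IX sch X) Rt gam (fun w => p_lt_opt wp s (gvec gam w))
        <= outage Pr (IX sch X) Rt gam p)%E).
Proof.
move=> _ _ _ P0 Rt0 _ gam_meas gamP wpP sP.
have PrE := pos_vec_as gamP.
have mE := measurable_pos_vec gam_meas.
split.
  rewrite avg_power_p_lt_opt.
  case: sP => [[-> LP]|[t [-> _ ->]]]; last exact: lexx.
  exact: le_trans (ER_pinfty_le gam_meas wpP) LP.
move=> p mp p0 pP.
rewrite (outage_p_lt_opt wpP) ?IX0//.
set A := [set w | _]; have mA : measurable A by exact: (measurable_Rregion gam_meas wpP s).
rewrite /outage; set O := [set w | _].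
have mO : measurable O.
  rewrite /O -[X in measurable X]setTI.
  apply: (measurable_fun_ltr _ _ measurableT) => //.
  apply: measurable_funM => //; apply: measurable_sum => b.
  apply: (measurableT_comp (@measurable_IX R sch M X)).
  by apply: measurable_funM; [exact: mp | exact: gam_meas].
set E := [set w | _] in PrE mE.
(* The competitor's non-outage event is cut down to positive gains, where [wp] is known to be
   minimal. *)
have mD : measurable (E `&` ~` O) by apply: measurableI => //; exact: measurableC.
have DA : (Pr (E `&` ~` O) <= Pr A)%E.
  apply: (measure_feasible_le gam_meas wpP PrE P0 sP mp p0 pP mD).
    exact: subIsetl.
  by move=> w [_ /negP]; rewrite -leNgt.
have E0 : Pr (~` E) = 0%E by rewrite probability_setC// PrE subee.
have : (Pr (O `|` ~` E) <= Pr O + Pr (~` E))%E.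
  exact: (measureU2 Pr mO (measurableC mE)).
rewrite E0 adde0; apply: le_trans.
rewrite (_ : O `|` ~` E = ~` (E `&` ~` O)); last by rewrite setCI setCK setUC.
by rewrite !probability_setC// leeB.
Qed.
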